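(* Let $f = f(x_1, \ldots, x_n)$ be a positive threshold Boolean function with $k \geq 0$ relevant variables. Then the number of extremal points of $f$ is at least $k+1$. Moreover, $f$ has exactly $k+1$ extremal points if and only if $f$ is linear read-once.
   Context: $B=\{0,1\}$; for $x,y\in B^n$, $x\preceq y$ means $(x)_i=1$ implies $(y)_i=1$ for all $i$. $f$ is positive if $f(x)=1$ and $x\preceq y$ imply $f(y)=1$. $f$ is a threshold function if there are reals $w_1,\dots,w_n,t$ with $f(x)=0 \iff \sum_i w_i x_i\le t$ for all $x\in B^n$. A variable $x_k$ is relevant for $f$ if the restrictions $f_{|x_k=1}$ and $f_{|x_k=0}$ (obtained by fixing $x_k$ to $1$, resp. $0$) are not identical. For positive $f$, an extremal point is a maximal (w.r.t. $\preceq$) false point (a point with $f=0$) or a minimal true point (a point with $f=1$). A Boolean function is linear read-once if it is constant or representable by a nested formula, defined recursively: the literals $x$ and $\bar{x}$ are nested formulas; if $t$ is a nested formula containing neither $x$ nor $\bar x$, then $x\vee t$, $x\wedge t$, $\bar x\vee t$, $\bar x\wedge t$ are nested formulas. *)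

(* Defs.v *)
From mathcomp Require Import all_boot all_order all_algebra reals.

Set Implicit Arguments.
Unset Strict Implicit.
Unset Printing Implicit Defensive.

Import GRing.Theory Num.Theory.
Local Open Scope ring_scope.

Definition point (n : nat) := {ffun 'I_n -> bool}.
Definition boolfun (n : nat) := point n -> bool.

Definition preceq (n : nat) (x y : point n) : bool :=
  [forall i, x i ==> y i].

Definition positive (n : nat) (f : boolfun n) : Prop :=
  forall x y : point n, f x -> preceq x y -> f y.

Definition threshold (R : realType) (n : nat) (f : boolfun n) : Prop :=
  exists (w : 'I_n -> R) (t : R),
    forall x : point n, f x = false <-> \sum_(i < n) w i * (x i)%:R <= t.

(* The point of B^n whose k-th coordinate is a and whose remaining n-1
   coordinates are, in order, those of y. *)
Definition insert_coord (n : nat) (k : 'I_n) (a : bool) (y : point n.-1) :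
    point n :=
  [ffun i => if unlift k i is Some j then y j else a].

Definition restriction (n : nat) (f : boolfun n) (k : 'I_n) (a : bool) :
    boolfun n.-1 :=
  fun y => f (insert_coord k a y).

Definition relevant (n : nat) (f : boolfun n) (k : 'I_n) : bool :=
  [exists y, restriction f k true y != restriction f k false y].

Definition maximal_false (n : nat) (f : boolfun n) (x : point n) : bool :=
  ~~ f x && [forall y, ~~ f y && preceq x y ==> (y == x)].

Definition minimal_true (n : nat) (f : boolfun n) (x : point n) : bool :=
  f x && [forall y, f y && preceq y x ==> (y == x)].

Definition extremal (n : nat) (f : boolfun n) (x : point n) : bool :=
  maximal_false f x || minimal_true f x.

(* [Lit i true] is the literal x_i and [Lit i false] its negation. *)
Inductive formula (n : nat) : Type :=
  | Lit of 'I_n & bool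
  | Or of formula n & formula n
  | And of formula n & formula n.

Fixpoint eval (n : nat) (t : formula n) (x : point n) : bool :=
  match t with
  | Lit i b => x i == b
  | Or t1 t2 => eval t1 x || eval t2 x
  | And t1 t2 => eval t1 x && eval t2 x
  end.

Fixpoint vars (n : nat) (t : formula n) : {set 'I_n} :=
  match t with
  | Lit i _ => [set i]
  | Or t1 t2 | And t1 t2 => vars t1 :|: vars t2
  end.

Inductive nested (n : nat) : formula n -> Prop :=
  | nested_Lit i b : nested (Lit i b)
  | nested_Or i b t : nested t -> i \notin vars t -> nested (Or (Lit i b) t)
  | nested_And i b t : nested t -> i \notin vars t -> nested (And (Lit i b) t).

Definition linear_read_once (n : nat) (f : boolfun n) : Prop :=
  (exists c : bool, forall x, f x = c) \/
  (exists2 t : formula n, nested t & forall x, f x = eval t x).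

(* Main.v *)
Require Import Defs.
From mathcomp Require Import all_boot all_order all_algebra reals.
From mathcomp Require Import lra zify.

(* Identify points of B^n with subsets of the index set, and let w be a vector of
   weights separating the true points from the false ones; only the relevant
   weights matter, and they are positive.

   Lower bound: if a vector (v, s), with v supported on the k relevant variables,
   satisfied v.x = s at every extremal point x, then w + l v would separate the
   extremal points of f for every l.  Increase l until some relevant weight
   vanishes while the others stay nonnegative: by monotonicity the new weights
   still separate f, although they ignore a relevant variable.  Hence the vectors
   (x, 1), x extremal, span a space of dimension k + 1.

   Equality: with k + 1 extremal points these vectors are linearly independent.
   Let x_n be a relevant variable of least weight.  Turning x_n off in a minimal
   true point containing it gives a maximal false point, so two such minimal true
   points would give a linear dependency.  Thus the two restrictions of f at x_n
   differ at a single point (up to irrelevant variables), and both have again one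
   more extremal point than relevant variables.  By induction each of them is
   forced by the value of one variable, and the single difference leaves no
   room for f not to be: f = x_a /\ g or f = x_a \/ g.  Passing from g to such an
   f adds exactly one extremal point and one relevant variable. *)

Set Implicit Arguments.
Unset Strict Implicit.
Unset Printing Implicit Defensive.

Import Order.TTheory GRing.Theory Num.Theory.

(** * Monotone set functions: extremal sets, relevant variables, duality *)

Section SetFunctions.
Variable T : finType.
Implicit Types (f g : {set T} -> bool) (A B : {set T}) (i j : T).

Definition mono f := forall A B, A \subset B -> f A -> f B.

(** Minimality is tested against deletion of single elements only; for monotone [f] this amounts to
    minimality among all true sets. [maxF] is local in the same way. *)
Definition minT f := [set A | f A && [forall i in A, ~~ f (A :\ i)]].

Definition maxF f := [set A | ~~ f A && [forall i in ~: A, f (i |: A)]].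

Definition ext f := maxF f :|: minT f.

(** Only a change from false to true is recorded: monotonicity excludes the opposite one. *)
Definition relvars f := [set i | [exists A, f (i |: A) && ~~ f (A :\ i)]].

Definition dual f := fun A => ~~ f (~: A).

(** For such an [a], [f] is the disjunction or the conjunction of [x_a] with a function that ignores
    [x_a]. *)
Definition splits f :=
  exists a, (forall A, a \in A -> f A) \/ (forall A, a \notin A -> ~~ f A).

Lemma minTP f A :
  reflect (f A /\ forall i, i \in A -> ~~ f (A :\ i)) (A \in minT f).
Proof.
rewrite inE; apply: (iffP andP) => [[fA /forall_inP h]|[fA h]]; split=> //.
exact/forall_inP.
Qed.

Lemma maxFP f A :
  reflect (~~ f A /\ forall i, i \notin A -> f (i |: A)) (A \in maxF f).
Proof.
rewrite inE; apply: (iffP andP) => [[fA /forall_inP h]|[fA h]]; split=> //.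
  by move=> i iA; apply: h; rewrite inE.
by apply/forall_inP => i; rewrite inE => /h.
Qed.

Lemma relvarsP f i : reflect (exists2 A, f (i |: A) & ~~ f (A :\ i)) (i \in relvars f).
Proof.
rewrite inE; apply: (iffP existsP) => [[A /andP[]]|[A h1 h2]]; exists A => //.
exact/andP.
Qed.

Lemma card_ext f : #|ext f| = #|maxF f| + #|minT f|.
Proof.
rewrite cardsU [_ :&: _](_ : _ = set0) ?cards0 ?subn0 //.
apply/setP => A; rewrite in_setI in_set0; apply/negbTE/negP.
by case/andP => /maxFP[/negbTE nA _] /minTP[]; rewrite nA.
Qed.

Lemma minT_dual f A : (A \in minT (dual f)) = (~: A \in maxF f).
Proof.
apply/minTP/maxFP => -[h1 h2]; split=> // i iA.
  by move: iA; rewrite inE negbK => /h2; rewrite /dual negbK setCD setUC.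
by rewrite /dual negbK setCD setUC h2 // inE negbK.
Qed.

Lemma maxF_dual f A : (A \in maxF (dual f)) = (~: A \in minT f).
Proof.
apply/maxFP/minTP; rewrite /dual negbK => -[h1 h2]; split=> // i iA.
  by move: iA; rewrite inE => /h2; rewrite setCU setIC -setDE.
by rewrite setCU setIC -setDE h2 // inE.
Qed.

Lemma card_ext_dual f : #|ext (dual f)| = #|ext f|.
Proof.
rewrite !card_ext addnC; congr (_ + _).
  rewrite -[RHS](card_imset _ (@setC_inj T)); apply: eq_card => A.
  by rewrite minT_dual -[in RHS](setCK A) (mem_imset _ _ (@setC_inj T)).
rewrite -[RHS](card_imset _ (@setC_inj T)); apply: eq_card => A.
by rewrite maxF_dual -[in RHS](setCK A) (mem_imset _ _ (@setC_inj T)).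
Qed.

Lemma relvars_dual f : relvars (dual f) = relvars f.
Proof.
apply/setP => i; apply/relvarsP/relvarsP => -[A h1 h2]; exists (~: A).
- by move: h2; rewrite /dual negbK setCD setUC.
- by move: h1; rewrite /dual setCU setIC -setDE.
- by move: h2; rewrite /dual setCU setCK setIC -setDE.
- by move: h1; rewrite /dual negbK setCD setCK setUC.
Qed.

Lemma mono_dual f : mono f -> mono (dual f).
Proof. by move=> fm A B AB; apply: contra; apply: fm; rewrite setCS. Qed.

Section Monotone.
Variable f : {set T} -> bool.
Hypothesis fm : mono f.

Lemma minT_below A : f A -> exists2 B, B \in minT f & B \subset A.
Proof.
move=> fA; have [B /minsetP[fB Bmin] BA] := @minset_exists T f A fA.
exists B => //; apply/minTP; split=> // i iB; apply/negP => fBi.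
by move: (Bmin _ fBi (subsetDl _ _)) iB => <-; rewrite setD11.
Qed.

Lemma minT_sub_relvars A : A \in minT f -> A \subset relvars f.
Proof.
case/minTP => fA h; apply/subsetP => i iA; apply/relvarsP; exists A; last exact: h.
by by rewrite (setUidPr _) // sub1set.
Qed.

(** A minimal true set below [A] consists of relevant variables, so it also lies below the
    intersection. *)
Lemma mono_relvars A : f (A :&: relvars f) = f A.
Proof.
apply/idP/idP => [|fA]; first exact/fm/subsetIl.
have [B Bm BA] := minT_below fA.
by case/minTP: (Bm) => + _; apply: fm; rewrite subsetI BA minT_sub_relvars.
Qed.

Lemma eq_mono_relvars A B : A :&: relvars f = B :&: relvars f -> f A = f B.
Proof. by move=> e; rewrite -mono_relvars e mono_relvars. Qed.

Lemma irrelU1 i A : i \notin relvars f -> f (i |: A) = f A.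
Proof.
move=> ir; apply: eq_mono_relvars; rewrite setIUl [_ :&: _](_ : _ = set0) ?set0U //.
by apply/setP => j; rewrite !in_set0 in_setI in_set1; case: eqVneq => // ->; apply/negbTE.
Qed.

Lemma irrelD1 i A : i \notin relvars f -> f (A :\ i) = f A.
Proof.
move=> ir; apply: eq_mono_relvars; apply/setP => j; rewrite !in_setI in_setD1.
by case: eqVneq => //= ->; rewrite (negbTE ir) andbF.
Qed.

Lemma irrel_sub_maxF A : A \in maxF f -> ~: relvars f \subset A.
Proof.
case/maxFP => nfA h; apply/subsetP => i; rewrite inE => ir.
by apply: contraR nfA => /h; rewrite irrelU1.
Qed.

Lemma maxF_above A : ~~ f A -> exists2 B, B \in maxF f & A \subset B.
Proof.
move=> nfA; have [|B fB AB] := @maxset_exists T (fun B => ~~ f B) A; first by [].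
case/maxsetP: fB => nfB Bmax; exists B => //; apply/maxFP; split=> // i iB.
by apply: contraR iB => nf; rewrite -(Bmax _ nf (subsetUr _ _)) setU11.
Qed.

Lemma card_ext_const : relvars f = set0 -> #|ext f| = 1.
Proof.
move=> r0.
have fE A B : f A = f B by apply: eq_mono_relvars; rewrite r0 !setI0.
suff [A ->]: exists A, ext f = [set A] by rewrite cards1.
have [f0|f0] := boolP (f set0); [exists set0 | exists setT]; apply/setP => A;
  rewrite in_set1 in_setU.
  apply/orP/eqP => [[/maxFP[]|/minTP[_ h]]|->].
  - by rewrite (fE _ set0) f0.
  - by apply/eqP; rewrite -subset0; apply/subsetP => i /h; rewrite (fE _ set0) f0.
  - by right; apply/minTP; split=> // i; rewrite inE.
apply/orP/eqP => [[/maxFP[_ h]|/minTP[]]|->].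
- apply/eqP; rewrite -subTset; apply/subsetP => i _.
  by apply: contraR f0 => /h; rewrite (fE _ set0).
- by rewrite (fE _ set0) (negbTE f0).
- by left; apply/maxFP; split=> [|i]; [rewrite (fE _ set0) | rewrite inE].
Qed.
End Monotone.

(** The maximal false sets of [f] are those of [g], which all contain the irrelevant [a], and the
    complement of [a]; the minimal true sets are those of [g] with [a] added. [g setT] makes the
    complement of [a] a new set and [a] relevant for [f]. *)
Lemma card_ext_and f g a : mono g -> a \notin relvars g -> g setT ->
  (forall A, f A = (a \in A) && g A) ->
  #|ext f| = #|ext g|.+1 /\ relvars f = a |: relvars g.
Proof.
move=> gm ar gT fE.
have gD A := irrelD1 gm A ar; have gU A := irrelU1 gm A ar.
have aminT A : A \in minT g -> a \notin A.
  by move/(minT_sub_relvars)=> /subsetP h; apply: contra ar => /h.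
split.
  rewrite !card_ext.
  have -> : maxF f = ~: [set a] |: maxF g.
    apply/setP => A; rewrite in_setU1.
    apply/maxFP/orP => [[nfA h]|[/eqP->|Am]].
    - have [aA|aA] := boolP (a \in A); [right | left].
        apply/maxFP; move: nfA; rewrite fE aA /=; split=> // i /h.
        by rewrite fE => /andP[].
      apply/eqP/setP => j; rewrite !inE; apply/idP/idP => [jA|].
        by apply: contraNneq aA => <-.
      by apply: contraR => /h; rewrite fE !inE (negbTE aA) orbF eq_sym => /andP[].
    - split=> [|i]; first by rewrite fE !inE eqxx.
      by rewrite !inE negbK => /eqP->; rewrite setUCr fE inE.
    - case/maxFP: (Am) => nA h.
      have aA : a \in A by apply: (subsetP (irrel_sub_maxF gm Am)); rewrite inE.
      split=> [|i /h gi]; rewrite fE ?(negbTE nA) ?andbF //.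
      by rewrite in_setU aA orbT.
  have -> : minT f = [set a |: A | A in minT g].
    apply/setP => A; apply/idP/imsetP => [/minTP[]|[B Bm ->]].
      rewrite fE => /andP[aA gA] h; exists (A :\ a); last by rewrite setD1K.
      apply/minTP; rewrite gD; split=> // i; rewrite !inE => /andP[ia /h].
      by rewrite fE !inE eq_sym ia aA /= setDDl setUC -setDDl gD.
    case/minTP: (Bm) => gB h; apply/minTP; rewrite fE setU11 gU; split=> // i.
    rewrite in_setU1 fE !inE => /orP[/eqP->|iB]; first by rewrite eqxx.
    rewrite negb_and; apply/orP; right.
    have ia : i != a by apply: contraNneq (aminT _ Bm) => <-.
    have -> : (a |: B) :\ i = a |: B :\ i.
      by apply/setP=> j; rewrite !inE; case: eqVneq => // ->; rewrite (negbTE ia).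
    by rewrite gU h.
  rewrite cardsU1 card_in_imset => [|A B Am Bm e].
    case: (boolP (_ \in _)) => [/maxFP[]|_]; last by rewrite addSn.
    by rewrite -gU setUCr gT.
  by rewrite -(setU1K (aminT _ Am)) e setU1K // aminT.
apply/setP => j; rewrite in_setU1.
apply/relvarsP/orP => [[A]|[/eqP->|/relvarsP[A h1 h2]]].
- rewrite !fE !in_setU1 !in_setD1 [j == a]eq_sym; case: eqVneq => //= ja; first by left.
  by case/andP=> aA h1; rewrite aA => h2; right; apply/relvarsP; exists A.
- by exists setT; rewrite fE ?setU11 ?inE ?eqxx // gU.
- have ja : a != j by apply: contraNneq ar => ->; apply/relvarsP; exists A.
  exists (a |: A); first by rewrite fE !in_setU1 eqxx orbT /= setUCA gU.
  rewrite fE in_setD1 setU11 ja /= setDUl (setDidPl _) ?gU //.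
  by rewrite disjoints1 in_set1.
Qed.

Lemma card_ext_or f g a : mono g -> a \notin relvars g -> ~~ g set0 ->
  (forall A, f A = (a \in A) || g A) ->
  #|ext f| = #|ext g|.+1 /\ relvars f = a |: relvars g.
Proof.
move=> gm ar g0 fE.
have := @card_ext_and (dual f) (dual g) a; rewrite !card_ext_dual !relvars_dual.
apply=> //.
- exact: mono_dual.
- by rewrite /dual setCT.
- by move=> A; rewrite /dual fE inE negb_or negbK.
Qed.

End SetFunctions.

(** * Separating weights and their perturbation *)

Section Separation.
Variables (R : realFieldType) (T : finType).
Implicit Types (f : {set T} -> bool) (w v : T -> R) (A B : {set T}).
Local Open Scope ring_scope.

(* Thresholdless form of separation, which [dual] visibly preserves. *)
Definition separates w f := forall A B, f A -> ~~ f B ->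
  \sum_(i in B) w i < \sum_(i in A) w i.

Lemma separates_dual w f : separates w f -> separates w (dual f).
Proof.
move=> fs A B nA; rewrite negbK => nB.
have := fs _ _ nB nA.
have e (C : {set T}) : \sum_(i in ~: C) w i = \sum_i w i - \sum_(i in C) w i.
  rewrite [\sum_i w i](bigID (mem C)) /= addrAC subrr add0r.
  by apply: eq_bigl => i; rewrite inE.
rewrite !e; lra.
Qed.

Lemma separates_pos w f i : separates w f -> i \in relvars f -> 0 < w i.
Proof.
move=> fs /relvarsP[A fA nA]; have := fs _ _ fA nA.
rewrite [X in _ < X](big_setD1 i) ?setU11 //= setDUl setDv set0U; lra.
Qed.

Lemma separates_relvars w f : mono f -> separates w f ->
  forall A B, f A -> ~~ f B ->
  \sum_(i in B :&: relvars f) w i < \sum_(i in A :&: relvars f) w i.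
Proof. by move=> fm fs A B fA nB; apply: fs; rewrite mono_relvars. Qed.

Lemma separates_D1 w f a : separates w f ->
  separates (fun i => if i == a then 0 else w i) (fun A => f (A :\ a)).
Proof.
move=> fs A B fA nB; have := fs _ _ fA nB.
have e C : \sum_(i in C :\ a) w i = \sum_(i in C) (if i == a then 0 else w i).
  rewrite [RHS](bigID (pred1 a)) /= [X in X + _]big1 ?add0r => [|i /andP[_ ->]//].
  apply: eq_big => [i|i]; first by rewrite !inE andbC.
  by rewrite !inE => /andP[/negbTE->].
by rewrite !e.
Qed.

(** Conjugation by [dual] turns deletion of [a] into insertion of [a]. *)
Lemma separates_U1 w f a : separates w f ->
  separates (fun i => if i == a then 0 else w i) (fun A => f (a |: A)).
Proof.
move/separates_dual/(separates_D1 (a := a))/separates_dual => fs A B fA nB.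
have e C : f (a |: C) = dual (fun A0 => dual f (A0 :\ a)) C.
  by rewrite /dual negbK setCD setCK setUC.
by rewrite !e in fA nB; apply: fs.
Qed.

(** If [v] had a negative relevant entry, moving [w] along [v] until a relevant weight vanishes
    would give nonnegative weights that still separate [f] while ignoring a relevant variable. *)
Lemma extremal_inj_ge0 w f v (s : R) : mono f -> separates w f ->
  {in ext f, forall A, \sum_(i in A :&: relvars f) v i = s} ->
  forall i, i \in relvars f -> 0 <= v i.
Proof.
move=> fm fs vs j jr; rewrite leNgt; apply/negP => vj.
pose P i := (i \in relvars f) && (v i < 0).
have Pj : P j by rewrite /P jr vj.
case: (arg_minP (fun i => w i / - v i) Pj) => m /andP[mr vm] mmin.
(* The least ratio over the negative entries of [v]: the first value of [l] at which a relevant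
   weight reaches zero. *)
pose l := w m / - v m; pose u i := w i + l * v i.
have um : u m = 0 by rewrite /u /l invrN mulrN mulNr mulfVK ?subrr // lt_eqF.
have l0 : 0 <= l by rewrite divr_ge0 // ?oppr_ge0 ltW // (separates_pos fs).
have u0 i : i \in relvars f -> 0 <= u i.
  move=> ir; have [vi|vi] := ltP (v i) 0.
    have := mmin i; rewrite /P ir vi => /(_ isT).
    rewrite ler_pdivlMr ?oppr_gt0 // -/l /u; lra.
  by apply: addr_ge0; [exact/ltW/(separates_pos fs ir) | exact: mulr_ge0].
have uE (A : {set T}) : \sum_(i in A :&: relvars f) u i =
    \sum_(i in A :&: relvars f) w i + l * \sum_(i in A :&: relvars f) v i.
  by rewrite big_split /= mulr_sumr.
have umono A B : A \subset B ->
    \sum_(i in A :&: relvars f) u i <= \sum_(i in B :&: relvars f) u i.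
  move=> AB; rewrite [leRHS](big_setID A) /= setIAC (setIidPr AB) lerDl.
  by apply: sumr_ge0 => i; rewrite !inE => /andP[_ /andP[_ ir]]; apply: u0; rewrite inE.
(* By [umono] it suffices to compare a minimal true set with a maximal false one; on both, [v] sums
   to [s], so the perturbation cancels. *)
have us A B : f A -> ~~ f B ->
    \sum_(i in B :&: relvars f) u i < \sum_(i in A :&: relvars f) u i.
  move=> fA nB; have [p pm pA] := minT_below fA; have [q qm Bq] := maxF_above nB.
  apply: le_lt_trans (umono _ _ Bq) (lt_le_trans _ (umono _ _ pA)).
  rewrite !uE !vs ?in_setU ?pm ?qm ?orbT // ltrD2r; apply: separates_relvars => //.
    by case/minTP: pm.
  by case/maxFP: qm.
case/relvarsP: (mr) => A fA nA; have := us _ _ fA nA.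
rewrite [X in _ < X](big_setD1 m) /= ?um ?in_setI ?setU11 ?mr // add0r.
suff -> : ((m |: A) :&: relvars f) :\ m = (A :\ m) :&: relvars f by rewrite ltxx.
apply/setP => i.
by rewrite in_setD1 !in_setI in_setD1 in_setU1; case: eqVneq.
Qed.

Lemma extremal_inj w f v (s : R) : mono f -> separates w f ->
  {in ext f, forall A, \sum_(i in A :&: relvars f) v i = s} ->
  forall i, i \in relvars f -> v i = 0.
Proof.
move=> fm fs vs i ir; apply/eqP; rewrite eq_le (extremal_inj_ge0 fm fs vs) // andbT.
rewrite -oppr_ge0; apply: (@extremal_inj_ge0 w f (fun i => - v i) (- s)) => // A Ae.
by rewrite sumrN vs.
Qed.
End Separation.

(** * Rank of the incidence matrix of a family of sets, extended by a column of ones *)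

Section Incidence.
Variables (F : fieldType) (T : finType) (E : {set {set T}}) (S : {set T}).
Local Open Scope ring_scope.

Hypothesis E_inj : forall (v : T -> F) (s : F),
  {in E, forall A, \sum_(i in A :&: S) v i = s} -> {in S, forall i, v i = 0} /\ s = 0.

Let M := row_mx (\matrix_(a < #|E|, i < #|S|) (enum_val i \in enum_val a)%:R)
                (const_mx 1) : 'M[F]_(#|E|, #|S| + 1).

Let MEl a i : M a (lshift 1 i) = (enum_val i \in enum_val a)%:R.
Proof. by rewrite /M row_mxEl mxE. Qed.

Let MEr a i : M a (rshift _ i) = 1.
Proof. by rewrite /M row_mxEr mxE. Qed.

(** [E_inj] says that [M] kills no nonzero column vector, so its columns are independent. *)
Let M_rank : \rank M = (#|S| + 1)%N.
Proof.
rewrite -mxrank_tr; apply/eqP; rewrite -/(row_free M^T) -kermx_eq0.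
apply/eqP/row_matrixP => r; rewrite row0; set x := row r _.
have xM : x *m M^T = 0 by apply/eqP; rewrite -sub_kermx row_sub.
have xMa a : \sum_j x 0 j * M a j = 0.
  transitivity ((x *m M^T) 0 a); last by rewrite xM mxE.
  by rewrite [RHS]mxE; apply: eq_bigr => j _; rewrite [M^T _ _]mxE.
move: x {xM} xMa => x xMa.
(* The kernel vector, indexed by an enumeration of [S], is carried over to [T] with value zero
   outside [S]. *)
pose v t := \sum_(i < #|S|) (if enum_val i == t then x 0 (lshift 1 i) else 0).
have vE i : v (enum_val i) = x 0 (lshift 1 i).
  rewrite /v (bigD1 i) //= eqxx big1 ?addr0 // => j /negbTE ji.
  by rewrite (inj_eq enum_val_inj) ji.
(* The column of ones adds the last coordinate to each sum, so that coordinate is [- s]. *)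
have [v0 s0] : {in S, forall i, v i = 0} /\ - x 0 (rshift _ ord0) = 0.
  apply: E_inj => A AE.
  have := xMa (enum_rank_in AE A); rewrite big_split_ord /= big_ord1 MEr mulr1.
  move/eqP; rewrite addr_eq0 => /eqP <-.
  rewrite (eq_bigl (fun i => (i \in S) && (i \in A))) => [|i]; last by rewrite inE andbC.
  rewrite big_mkcondr /= big_enum_val /=; apply: eq_bigr => i _.
  by rewrite MEl enum_rankK_in // vE; case: ifP; rewrite ?mulr1 ?mulr0.
apply/rowP => c; rewrite [RHS]mxE; case: (split_ordP c) => i ->.
  by rewrite -vE v0 // enum_valP.
by rewrite ord1; apply/eqP; rewrite -oppr_eq0 s0.
Qed.

Lemma incidence_card : (#|S| < #|E|)%N.
Proof. by have := rank_leq_row M; rewrite M_rank addn1. Qed.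

(** With this cardinality [M] has as many rows as columns, so its full column rank makes the rows
    independent too. *)
Lemma incidence_free (c : {set T} -> F) : #|E| = #|S|.+1 ->
  {in S, forall i, \sum_(A in E) c A * (i \in A)%:R = 0} ->
  \sum_(A in E) c A = 0 -> {in E, forall A, c A = 0}.
Proof.
move=> ES cS c0 A AE.
have Mfree : row_free M by rewrite /row_free M_rank ES addn1.
pose x := \row_(a < #|E|) c (enum_val a).
suff x0 : x = 0.
  by have := congr1 (fun y : 'M_(_, _) => y 0 (enum_rank_in AE A)) x0;
     rewrite !mxE enum_rankK_in.
apply: (row_free_inj Mfree); rewrite mul0mx; apply/rowP => j; rewrite [LHS]mxE [RHS]mxE.
case: (split_ordP j) => i ->.
  rewrite -[RHS](cS _ (enum_valP i)) [RHS]big_enum_val /=.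
  by apply: eq_bigr => a _; rewrite MEl mxE.
rewrite -[RHS]c0 [RHS]big_enum_val /=.
by apply: eq_bigr => a _; rewrite MEr mxE mulr1.
Qed.
End Incidence.

(** * Lower bound, and independence in the case of equality *)

Section ExtremalCount.
Variables (R : realFieldType) (T : finType) (w : T -> R) (f : {set T} -> bool).
Hypotheses (fm : mono f) (fs : separates w f).
Local Open Scope ring_scope.

Lemma ext_inj (v : T -> R) (s : R) :
  {in ext f, forall A, \sum_(i in A :&: relvars f) v i = s} ->
  {in relvars f, forall i, v i = 0} /\ s = 0.
Proof.
move=> vs; have v0 := extremal_inj fm fs vs; split=> //.
have [A Ae] : exists A, A \in ext f.
  have [/(minT_below) [A Am _]|/(maxF_above) [A Am _]] := boolP (f set0);
    by exists A; rewrite in_setU Am ?orbT.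
by rewrite -(vs A Ae) big1 // => i; rewrite inE => /andP[_ /v0].
Qed.

Lemma card_ext_ge : (#|relvars f| < #|ext f|)%N.
Proof. exact: incidence_card ext_inj. Qed.

Lemma ext_free (c : {set T} -> R) : #|ext f| = #|relvars f|.+1 ->
  {in relvars f, forall i, \sum_(A in ext f) c A * (i \in A)%:R = 0} ->
  \sum_(A in ext f) c A = 0 -> {in ext f, forall A, c A = 0}.
Proof. exact: incidence_free ext_inj _. Qed.
End ExtremalCount.

Lemma mono_D1 (T : finType) (f : {set T} -> bool) a :
  mono f -> mono (fun A => f (A :\ a)).
Proof. by move=> fm A B AB; apply: fm; rewrite setSD. Qed.

Lemma mono_U1 (T : finType) (f : {set T} -> bool) a :
  mono f -> mono (fun A => f (a |: A)).
Proof. by move=> fm A B AB; apply: fm; rewrite setUS. Qed.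

(** * Extremal pairs that differ in a lightest relevant variable *)

Section LightestPair.
Variables (R : realFieldType) (T : finType) (w : T -> R) (f : {set T} -> bool).
Variable n : T.
Hypotheses (fm : mono f) (fs : separates w f).
Hypothesis nmin : forall i, i \in relvars f -> (w n <= w i)%R.
Implicit Types A B p q : {set T}.

(** All irrelevant variables are added, since a maximal false set contains them. Turning [n] on
    again gives a set above [p]; turning on another relevant [i] exchanges [n] for a variable at
    least as heavy, so separation from the true set [p] excludes the value false. *)
Lemma lightest_minT_maxF p :
  p \in minT f -> n \in p -> (p :\ n) :|: ~: relvars f \in maxF f.
Proof.
move=> pm np; have pr := subsetP (minT_sub_relvars pm); case/minTP: pm => fp ph.
have qE : ((p :\ n) :|: ~: relvars f) :&: relvars f = p :\ n.
  apply/setP => i; rewrite in_setI in_setU in_setC in_setD1.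
  by case: (boolP (i \in p)) => [/pr->|_]; rewrite ?andbT ?orbF ?andbF ?orNb //=;
    case: (i \in _).
apply/maxFP; split=> [|i]; first by rewrite -mono_relvars // qE ph.
rewrite in_setU in_setC negb_or negbK in_setD1 => /andP[ip ir].
have [->|iN] := eqVneq i n.
  by apply: fm fp; rewrite -{1}(setD1K np) setUS // subsetUl.
have {}ip : i \notin p by move: ip; rewrite iN.
apply: contraT => nf; have := separates_relvars fm fs fp nf.
have -> : p :&: relvars f = p by apply/setIidPl/subsetP.
rewrite setIUl qE (setIidPl _) ?sub1set // big_setU1 ?in_setD1 ?negb_and ?ip ?orbT //=.
by rewrite (big_setD1 n np) /= ltrD2r ltNge nmin.
Qed.

End LightestPair.

Section Step.
Variables (R : realFieldType) (T : finType) (w : T -> R) (f : {set T} -> bool).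
Variable n : T.
Hypotheses (fm : mono f) (fs : separates w f) (nr : n \in relvars f).
Hypothesis nmin : forall i, i \in relvars f -> (w n <= w i)%R.
Hypothesis fcard : #|ext f| = #|relvars f|.+1.
Implicit Types A B p q : {set T}.

Lemma lightest_maxF_minT q :
  q \in maxF f -> n \notin q -> n |: (q :&: relvars f) \in minT f.
Proof.
move=> qm nq.
have := @lightest_minT_maxF _ _ w (dual f) n (mono_dual fm) (separates_dual fs).
rewrite relvars_dual => /(_ nmin (~: q)).
rewrite minT_dual setCK maxF_dual => /(_ qm); rewrite inE => /(_ nq).
by rewrite setCU setCD !setCK setUC setIUl (setIidPl (_ : [set n] \subset _)) // sub1set.
Qed.

(* Two pairs p, p' would give the affine relation p - q = p' - q' between
   extremal points. *)
Lemma lightest_minT_unique p p' :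
  p \in minT f -> p' \in minT f -> n \in p -> n \in p' -> p' = p.
Proof.
move=> pm pm' np np'; apply/eqP; apply: contraT => pp'.
pose q := (p :\ n) :|: ~: relvars f; pose q' := (p' :\ n) :|: ~: relvars f.
have qm : q \in maxF f := lightest_minT_maxF fm fs nmin pm np.
have qm' : q' \in maxF f := lightest_minT_maxF fm fs nmin pm' np'.
have dis A B : A \in minT f -> B \in maxF f -> (A == B) = false.
  by move=> /minTP[fA _] /maxFP[nB _]; apply: contraTF fA => /eqP->.
have pE x : x \in minT f -> n \in x -> x = n |: ((x :\ n :|: ~: relvars f) :&: relvars f).
  move=> xm nx; rewrite setIUl [~: _ :&: _]setIC setICr setU0.
  rewrite (setIidPl _) ?setD1K //.
  by apply: subset_trans (minT_sub_relvars xm); apply: subsetDl.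
have qq' : (q == q') = false.
  apply: contraNF pp' => /eqP e; rewrite (pE p) // (pE p') //.
  by rewrite -/q -/q' e.
(* Coefficients of [p - q - p' + q']. At [n] the terms [p] and [p'] cancel; at any other relevant
   variable [q] agrees with [p] and [q'] with [p']. *)
pose c A : R := ((A == p)%:R - (A == q)%:R - (A == p')%:R + (A == q')%:R)%R.
have sumd (g : {set T} -> R) B : B \in ext f ->
    (\sum_(A in ext f) (A == B)%:R * g A = g B)%R.
  move=> Be; rewrite (bigD1 B) //= eqxx mul1r big1 ?addr0 // => A /andP[_ /negbTE->].
  by rewrite mul0r.
have sumc (g : {set T} -> R) :
    (\sum_(A in ext f) c A * g A = g p - g q - g p' + g q')%R.
  rewrite -!(sumd g) ?in_setU ?pm ?pm' ?qm ?qm' ?orbT // -!sumrN -!big_split /=.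
  by apply: eq_bigr => A _; rewrite /c !mulrDl !mulNr.
have := ext_free fm fs (c := c) fcard _ _.
have cs : {in relvars f, forall i, \sum_(A in ext f) c A * (i \in A)%:R = 0}%R.
  move=> i ir; rewrite sumc /q /q' !in_setU !in_setC ir !orbF !in_setD1.
  by case: (eqVneq i n) => [->|_] /=; rewrite ?np ?np' /=; lra.
have c0 : (\sum_(A in ext f) c A = 0)%R.
  rewrite (eq_bigr (fun A => c A * 1)%R) => [|A _]; last by rewrite mulr1.
  rewrite (sumc (fun=> 1%R)); lra.
move=> /(_ cs c0 p); rewrite in_setU pm orbT => /(_ isT) /eqP.
rewrite /c eqxx (dis p q) // (dis p q') //.
by rewrite [p == p']eq_sym (negbTE pp') addr0 !subr0 oner_eq0.
Qed.

(** Where the restrictions at [n] differ, take a minimal true set below [n |: A] and a maximal false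
    set above [A :\ n]. By uniqueness they coincide on relevant variables apart from [n], and
    [A :\ n] is squeezed between them. *)
Lemma lightest_pair : exists p, [/\ p \in minT f, n \in p,
  forall p', p' \in minT f -> n \in p' -> p' = p &
  forall A, f (n |: A) -> ~~ f (A :\ n) -> (A :\ n) :&: relvars f = p :\ n].
Proof.
have pair A : f (n |: A) -> ~~ f (A :\ n) -> exists p,
    [/\ p \in minT f, n \in p & (A :\ n) :&: relvars f = p :\ n].
  move=> fA nA; have [p pm pA] := minT_below fA; have [q qm Aq] := maxF_above nA.
  have np : n \in p.
    apply: contraT => np; case/minTP: pm => fp _.
    move: nA; rewrite (fm _ fp) // subsetD1 np andbT.
    apply/subsetP => z zp; have := subsetP pA z zp; rewrite in_setU1 => /orP[/eqP e|//].
    by rewrite -e zp in np.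
  have nq : n \notin q.
    apply: contraT; rewrite negbK => nq; case/maxFP: qm => nfq _.
    by move: nfq; rewrite (fm _ fA) // -(setD1K nq) subUset sub1set setU11 /=
      -subDset subsetD1 setD11 andbT.
  have e := lightest_minT_unique pm (lightest_maxF_minT qm nq) np (setU11 _ _).
  exists p; split=> //; apply/eqP; rewrite eqEsubset; apply/andP; split.
    by rewrite -e setU1K ?in_setI ?(negbTE nq) // setSI.
  rewrite subsetI (subset_trans (subsetDl _ _) (minT_sub_relvars pm)) andbT.
  by rewrite subsetD1 setD11 andbT subDset.
case/relvarsP: (nr) => A0 fA0 nA0; have [p [pm np _]] := pair _ fA0 nA0.
have uniq p' : p' \in minT f -> n \in p' -> p' = p.
  by move=> pm' np'; apply: lightest_minT_unique pm pm' np np'.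
exists p; split=> // A fA nA; have [p' [pm' np' ->]] := pair _ fA nA.
by rewrite (uniq p').
Qed.

Let f0 A := f (A :\ n).

Lemma relvars_D1 : relvars f0 \subset relvars f :\ n.
Proof.
apply/subsetP => i /relvarsP[A]; rewrite /f0 => h1 h2; rewrite in_setD1.
have iN : i != n.
  by apply: contraNneq h2 => e; move: h1; rewrite e setDUl setDv set0U !setDDl setUid.
rewrite iN; apply/relvarsP; exists (A :\ n).
  by apply: fm h1; rewrite setDUl setSU // subsetDl.
by rewrite setDDl setUC -setDDl.
Qed.

(** The lower bound is [card_ext_ge]. For the upper bound, [f0] loses the minimal true set [p], the
    maximal false set [q] and one maximal false set for each variable of [S0], and gains at most
    [top]. *)
Lemma card_ext_D1 : #|ext f0| = #|relvars f0|.+1.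
Proof.
have f0m : mono f0 := mono_D1 (a := n) fm.
apply/eqP; rewrite eqn_leq (card_ext_ge f0m (separates_D1 fs)) andbT.
have [p [pm np uniq fdiff]] := lightest_pair.
have pr := subsetP (minT_sub_relvars pm).
pose q := (p :\ n) :|: ~: relvars f; pose top := n |: q.
have qm : q \in maxF f := lightest_minT_maxF fm fs nmin pm np.
pose S0 := (relvars f :\ n) :\: relvars f0.
(* Variables that become irrelevant in f0 each cost one maximal false point. *)
pose bad := [set top :\ i | i in S0].
have nq : n \notin q by rewrite in_setU in_setD1 eqxx in_setC nr.
have S0P i : i \in S0 -> [/\ i != n, i \in relvars f & i \notin relvars f0].
  by rewrite in_setD in_setD1 => /andP[? /andP[]].
have D1n A : n \notin A -> A :\ n = A.
  by move=> nA; apply/setDidPl; rewrite disjoint_sym disjoints1.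
(* Otherwise adding [i] to [q] would make it true with [n] still off, although [f0] ignores [i]. *)
have S0q i : i \in S0 -> i \in q.
  case/S0P=> iN ir ir0; apply: contraT => iq; case/maxFP: qm => nfq /(_ i iq).
  have := irrelU1 f0m q ir0; rewrite /f0 !D1n ?(negbTE nfq) => [->//|//|].
  by rewrite in_setU1 negb_or eq_sym iN.
have [nfq hq] := maxFP _ _ qm; have [fp hp] := minTP _ _ pm.
have subm : minT f0 \subset minT f :\ p.
  apply/subsetP => A Am.
  have nA : n \notin A.
    apply: contraTN isT => nA; have := subsetP (minT_sub_relvars Am) _ nA.
    by move/(subsetP relvars_D1); rewrite setD11.
  case/minTP: Am; rewrite /f0 D1n // => fA hA; rewrite in_setD1; apply/andP; split.
    by apply: contraNneq nA => ->.
  apply/minTP; split=> // i /hA; rewrite D1n //.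
  by rewrite in_setD1 (negbTE nA) andbF.
(* A maximal false [A] of [f0] contains [n] and all of [S0]. If [f A], the restrictions differ at
   [A], which forces [A = top]; otherwise [A] is already maximal false for [f]. *)
have subM : maxF f0 \subset top |: (maxF f :\: (q |: bad)).
  apply/subsetP => A Am; rewrite in_setU1 in_setD in_setU1 negb_or.
  have Air := subsetP (irrel_sub_maxF f0m Am).
  have nA : n \in A.
    by apply: Air; rewrite in_setC; apply/negP => /(subsetP relvars_D1); rewrite setD11.
  case/maxFP: Am; rewrite /f0 => nfA hA.
  have [fA|nfA'] := boolP (f A).
    apply/orP; left; have := fdiff A.
    rewrite (setUidPr (_ : [set n] \subset A)) ?sub1set // => /(_ fA nfA) e.
    apply/eqP; rewrite -(setD1K nA) /top /q -e; congr (_ |: _).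
    apply/setP => i; rewrite in_setU in_setI in_setC !in_setD1.
    have [ir|ir] := boolP (i \in relvars f); first by rewrite andbT orbF.
    rewrite andbF /= Air ?andbT ?in_setC; first by apply: contraNneq ir => ->.
    by apply: contra ir => /(subsetP relvars_D1); rewrite in_setD1 => /andP[].
  apply/orP; right; rewrite -andbA; apply/and3P; split.
  - by apply: contraNneq nq => <-.
  - apply/imsetP => -[i iS e]; have [_ _ ir0] := S0P i iS.
    by have := Air i; rewrite in_setC e setD11 => /(_ ir0).
  - by apply/maxFP; split=> // i /hA; apply: fm; apply: subsetDl.
(* On relevant variables [top :\ i] is [p :\ i], hence false. Adding [i] gives a set above [p];
   adding [j] outside [top] gives a set above [(j |: q) :\ i], which is true because [j |: q] is and
   [f0] ignores [i]. *)
have badm : bad \subset maxF f.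
  apply/subsetP => _ /imsetP[i iS ->]; have [iN ir ir0] := S0P i iS.
  have ip : i \in p.
    by move: (S0q i iS); rewrite in_setU in_setC ir orbF in_setD1 => /andP[].
  have ptop : p \subset top by rewrite -(setD1K np) setUS // subsetUl.
  apply/maxFP; split=> [|j].
    rewrite (eq_mono_relvars fm (B := p :\ i)) ?hp //; apply/setP => j.
    rewrite !in_setI !in_setD1 in_setU1 in_setU in_setC in_setD1.
    have [->|jn] := eqVneq j n; first by rewrite np.
    by case: (j \in relvars f); rewrite ?andbF ?orbF.
  rewrite in_setD1 negb_and negbK => /orP[/eqP->|jtop].
    by apply: fm fp; rewrite setD1K // in_setU1 S0q ?orbT.
  move: jtop; rewrite in_setU1 negb_or => /andP[jn jq].
  have := irrelD1 f0m (j |: q) ir0; rewrite /f0 D1n; last first.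
    by rewrite in_setD1 in_setU1 [n == j]eq_sym (negbTE jn) (negbTE nq) andbF.
  rewrite D1n; last by rewrite in_setU1 negb_or eq_sym jn.
  rewrite hq // => fj; apply: fm fj; rewrite setDUl; apply: setUSS; first exact: subsetDl.
  by rewrite setSD // subsetUr.
have cbad : #|bad| = #|S0|.
  apply: card_in_imset => i j /S0q iq /S0q jq e; apply/eqP; apply: contraT => ij.
  have : i \in top :\ j by rewrite in_setD1 ij in_setU1 iq orbT.
  by rewrite -e setD11.
have qbad : q \notin bad.
  apply/imsetP => -[i /S0P[iN _ _] e]; move: nq; rewrite e.
  by rewrite in_setD1 in_setU1 eqxx eq_sym iN.
have cS0 : #|S0| = (#|relvars f|.-1 - #|relvars f0|)%N.
  rewrite cardsDS ?relvars_D1 //; congr (_ - _).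
  by rewrite (cardsD1 n (relvars f)) nr.
have := subset_leq_card subm; have := subset_leq_card subM.
have := subset_leq_card relvars_D1.
have := cardsD1 n (relvars f); rewrite nr.
have := cardsD1 p (minT f); rewrite pm.
have qbs : q |: bad \subset maxF f by rewrite subUset sub1set qm.
have := cardsDS qbs; have := subset_leq_card qbs; rewrite !cardsU1 qbad cbad.
have := fcard; rewrite !card_ext; move: (top \notin _) => b.
move: cS0; case: b => /=; lia.
Qed.

End Step.

(** Induction on the number of relevant variables, restricting at a lightest one, [n]. If a
    restriction is constant, [n] itself splits [f]; otherwise both restrictions split, and the
    single difference between them is used when neither splitting passes to [f] directly. *)
Lemma ext_splits (R : realFieldType) (T : finType) (w : T -> R) (f : {set T} -> bool) :
  mono f -> separates w f -> #|ext f| = #|relvars f|.+1 -> relvars f != set0 ->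
  splits f.
Proof.
have [N] := ubnP #|relvars f|; elim: N w f => // N IH w f fN fm fs fcard /set0Pn[i0 i0r].
case: (arg_minP w i0r) => n nr nmin; have {}nr : n \in relvars f := nr.
have fltN : #|relvars f :\ n| < N by move: fN; rewrite (cardsD1 n) nr.
have [fT|fT] := boolP (f (setT :\ n)); last first.
  exists n; right=> A nA; apply: contra fT; apply: fm.
  by rewrite subsetD1 subsetT.
have [fn|fn] := boolP (f [set n]).
  by exists n; left=> A nA; apply: fm fn; rewrite sub1set.
have f0 : ~~ f set0 by apply: contra fn; apply/fm/sub0set.
(* Stated for a general [g] to serve both [f] and [dual f]: fixing [x_n] to 1 in [f] is dual to
   fixing it to 0 in [dual f]. *)
have sub (g : {set T} -> bool) : mono g -> separates w g -> #|ext g| = #|relvars g|.+1 ->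
    relvars g = relvars f -> g (setT :\ n) -> ~~ g set0 -> splits (fun A => g (A :\ n)).
  move=> gm gs gcard ge gT g0; rewrite -ge in nr nmin fltN.
  have g0m := mono_D1 (a := n) gm; have := relvars_D1 n gm.
  move=> /subset_leq_card gle.
  apply: (IH _ _ (leq_ltn_trans gle fltN) g0m (separates_D1 gs)) => //.
    exact: card_ext_D1 gm gs nr nmin gcard.
  apply: contra g0 => /eqP r0.
  by have := eq_mono_relvars g0m (A := setT) (B := set0); rewrite r0 !setI0 set0D => <-.
have [a [Ha|Ha]] : splits (fun A => f (A :\ n)) by apply: sub.
  by exists a; left=> A /Ha; apply/fm/subsetDl.
have dE A : dual f (~: A :\ n) = ~~ f (n |: A).
  by rewrite /dual setCD setCK setUC.
have [b [Hb|Hb]] : splits (fun A => dual f (A :\ n)).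
- apply: sub; rewrite ?card_ext_dual ?relvars_dual //.
  + exact: mono_dual.
  + exact: separates_dual.
  + by rewrite -setC0 dE setU0.
  + by rewrite /dual setC0 negbK; apply: fm fT; apply: subsetT.
- exists b; right=> A bA; have := Hb (~: A); rewrite inE dE => /(_ bA).
  by apply: contra; apply/fm/subsetUr.
(* The remaining case: without [a] the restriction at [x_n = 0] is false, with [b] the restriction
   at [x_n = 1] is true. *)
have {}Hb (A : {set T}) : b \in A -> f (n |: A).
  by move=> bA; have := Hb (~: A); rewrite inE dE !negbK; apply.
have [p [pm np _ fdiff]] := lightest_pair fm fs nr nmin fcard.
have aN : a != n.
  apply: contraTneq fT => an; have := Ha (setT :\ n).
  by rewrite an setD11 setDDl setUid; apply.
have bN : b != n.
  apply: contraNneq fn => bn; have := Hb [set n].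
  by rewrite bn set11 setUid; apply.
have ar : a \in relvars f.
  apply: contraTT fT => ar; rewrite -(irrelD1 fm _ ar) setDDl setUC -setDDl.
  by apply: Ha; rewrite setD11.
have br : b \in relvars f.
  apply: contraNT fn => br; rewrite -(irrelU1 fm _ br) setUC.
  by apply: Hb; rewrite set11.
case: (boolP [exists A : {set T}, (a \notin A) && f A]); last first.
  by move=> /existsPn h; exists a; right=> A aA; have := h A; rewrite aA.
move=> /existsP[A /andP[aA fA]].
case: (boolP [exists A : {set T}, (b \in A) && ~~ f A]); last first.
  by move=> /existsPn h; exists b; left=> B bB; have := h B; rewrite bB negbK.
move=> /existsP[B /andP[bB nB]].
(* If neither [a] nor [b] splits [f] in this way, the witnesses [A] and [B] are both places where
   the restrictions differ, so both project to [p]. *)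
have ap : a \notin p.
  have e : (A :\ n) :&: relvars f = p :\ n.
    by apply: fdiff; [apply: fm fA; apply: subsetUr | apply: Ha].
  have : a \notin p :\ n by rewrite -e in_setI in_setD1 (negbTE aA) andbF.
  by rewrite in_setD1 aN.
have bp : b \in p.
  have e : (B :\ n) :&: relvars f = p :\ n.
    by apply: fdiff; [apply: Hb | apply: contra nB; apply/fm/subsetDl].
  have : b \in p :\ n by rewrite -e in_setI in_setD1 bN bB br.
  by rewrite in_setD1 bN.
(* By maximality of the false partner of [p], adding [z] makes it true with [n] off; by [Ha] it
   would then contain [a]. *)
have relE z : z \in relvars f -> z != n -> z != a -> z \in p.
  move=> zr zn za; apply: contraT => zp.
  have /maxFP[_ /(_ z)] := lightest_minT_maxF fm fs nmin pm np.
  rewrite in_setU in_setC in_setD1 zr (negbTE zp) andbF => /(_ isT).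
  set q := z |: _ => fq; have := Ha q; rewrite (setDidPl _); last first.
    rewrite disjoint_sym disjoints1 in_setU1 in_setU in_setC in_setD1 eqxx nr.
    by rewrite eq_sym (negbTE zn).
  rewrite fq in_setU1 in_setU in_setC in_setD1 ar (negbTE ap) andbF.
  by rewrite [a == z]eq_sym (negbTE za) => /(_ isT).
(* Otherwise [p :\ z] still contains [n] and [b], so it is true, against minimality of [p]. Only
   [n], [a] and [b] can now be relevant. *)
have pE z : z \in p -> z != n -> z = b.
  move=> zp zn; apply/eqP; apply: contraT => zb.
  case/minTP: pm => _ /(_ z zp) /negP[].
  have := Hb (p :\ z); rewrite in_setD1 eq_sym zb bp => /(_ isT).
  by rewrite (setUidPr _) // sub1set in_setD1 eq_sym zn.
have [fa|fa] := boolP (f [set a]).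
  by exists a; left=> C aC; apply: fm fa; rewrite sub1set.
exists b; right=> C bC; apply/negP => fC.
have e : ([set a] :\ n) :&: relvars f = p :\ n.
  apply: fdiff; last by apply: contra fa; apply/fm/subsetDl.
  rewrite -(mono_relvars fm) in fC; apply: fm fC; apply/subsetP => z.
  rewrite in_setI in_setU1 in_set1 => /andP[zC zr].
  have [//|zn] := eqVneq z n; have [//|za] := eqVneq z a.
  by move: bC; rewrite -(pE z) ?zC // relE.
have : b \in p :\ n by rewrite in_setD1 bN.
rewrite -e in_setI in_setD1 in_set1 => /andP[/andP[_ /eqP ba] _].
by rewrite -ba bp in ap.
Qed.

(** * Points as sets, and evaluation of nested formulas *)

Definition point_of n (A : {set 'I_n}) : point n := [ffun i => i \in A].

Definition set_of_point n (x : point n) : {set 'I_n} := [set i | x i].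

Lemma point_ofK n : cancel (@point_of n) (@set_of_point n).
Proof. by move=> A; apply/setP => i; rewrite inE ffunE. Qed.

Lemma set_of_pointK n : cancel (@set_of_point n) (@point_of n).
Proof. by move=> x; apply/ffunP => i; rewrite ffunE inE. Qed.

Lemma eq_eval n (t : formula n) (x y : point n) :
  {in vars t, x =1 y} -> eval t x = eval t y.
Proof.
elim: t => [i b|t1 IH1 t2 IH2|t1 IH1 t2 IH2] /= xy; first by rewrite xy // set11.
  by rewrite IH1 ?IH2 // => i it; apply: xy; rewrite in_setU it ?orbT.
by rewrite IH1 ?IH2 // => i it; apply: xy; rewrite in_setU it ?orbT.
Qed.

(** The outer variable does not occur in the rest, so it can be given the value neutral for the
    connective. *)
Lemma nested_surj n (t : formula n) : nested t -> forall c, exists x, eval t x = c.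
Proof.
elim=> [i b|i b t' _ IH it|i b t' _ IH it] c.
- exists [ffun => if c then b else ~~ b]; rewrite /= ffunE.
  by case: c b => -[].
- have [x xc] := IH c; exists [ffun j => if j == i then ~~ b else x j] => /=.
  rewrite ffunE eqxx [~~ b == b](_ : _ = false) /=; last by case: b.
  rewrite -xc; apply: eq_eval => j jt; rewrite ffunE.
  by case: eqVneq => // e; rewrite e (negbTE it) in jt.
- have [x xc] := IH c; exists [ffun j => if j == i then b else x j] => /=.
  rewrite ffunE eqxx eqxx /= -xc; apply: eq_eval => j jt; rewrite ffunE.
  by case: eqVneq => // e; rewrite e (negbTE it) in jt.
Qed.

(** * Linear read-once functions and the equality case *)

Section NestedCount.
Variable n : nat.
Implicit Types (f g : {set 'I_n} -> bool) (A : {set 'I_n}) (t : formula n).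

Lemma eval_U1 t i A : i \notin vars t ->
  eval t (point_of (i |: A)) = eval t (point_of A).
Proof.
move=> it; apply: eq_eval => j jt; rewrite !ffunE in_setU1.
by case: eqVneq => // e; rewrite -e jt in it.
Qed.

Lemma eval_D1 t i A : i \notin vars t ->
  eval t (point_of (A :\ i)) = eval t (point_of A).
Proof.
move=> it; apply: eq_eval => j jt; rewrite !ffunE in_setD1.
by case: eqVneq => // e; rewrite -e jt in it.
Qed.

Lemma eval_irrel t i : i \notin vars t -> i \notin relvars (fun A => eval t (point_of A)).
Proof.
by move=> it; apply/relvarsP => -[A]; rewrite eval_U1 // eval_D1 // => ->.
Qed.

(** Each connective adds one extremal set and one relevant variable, by [card_ext_or] and
    [card_ext_and]; a single literal is treated as its conjunction with the constant true. *)
Lemma nested_card_ext t : nested t -> forall f, mono f ->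
  (forall A, f A = eval t (point_of A)) -> #|ext f| = #|relvars f|.+1.
Proof.
elim=> [i b|i b t' nt' IH it|i b t' nt' IH it] f fm fE.
- have iE A : f A = ((i \in A) == b) by rewrite fE /= ffunE.
  case: b iE {fE} => iE; last first.
    have : f set0 by rewrite iE inE.
    by move/(fm _ _ (subsetT _)); rewrite iE inE.
  have cm : mono (fun _ : {set 'I_n} => true) by [].
  have r0 : relvars (fun _ : {set 'I_n} => true) = set0.
    by apply/setP => j; rewrite in_set0; apply/relvarsP => -[].
  have [|||-> ->] := @card_ext_and _ f (fun=> true) i cm => //.
  - by rewrite r0 inE.
  - by move=> A; rewrite iE eqb_id andbT.
  by rewrite (card_ext_const cm) // r0 setU0 cards1.
- pose g A := eval t' (point_of A).
  have gE A : f A = ((i \in A) == b) || g A by rewrite fE /= ffunE.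
  have gU A : g (i |: A) = g A := eval_U1 A it.
  have gD A : g (A :\ i) = g A := eval_D1 A it.
  have [x0 gx0] := nested_surj nt' false.
  have nx0 : g (set_of_point x0) = false by rewrite /g set_of_pointK.
  (* A negated literal contradicts monotonicity: where [g] is false, turning [i] on would turn [f]
     from true to false. *)
  case: b gE {fE} => gE; last first.
    have : f (set_of_point x0 :\ i) by rewrite gE !inE eqxx.
    have sub := subset_trans (subsetDl (set_of_point x0) [set i]) (subsetU1 i _).
    by move/(fm _ _ sub); rewrite gE !inE eqxx /= gU nx0.
  have gm : mono g.
    move=> A B AB; have := fm _ _ (setSD [set i] AB).
    by rewrite !gE !inE !eqxx /= !gD.
  have [|||-> ->] := @card_ext_or _ f g i gm => //.
  - exact: eval_irrel.
  - by apply: contraFN nx0; apply/gm/sub0set.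
  - by move=> A; rewrite gE eqb_id.
  by rewrite (IH g gm) // cardsU1 eval_irrel.
- pose g A := eval t' (point_of A).
  have gE A : f A = ((i \in A) == b) && g A by rewrite fE /= ffunE.
  have gU A : g (i |: A) = g A := eval_U1 A it.
  have gD A : g (A :\ i) = g A := eval_D1 A it.
  have [x1 gx1] := nested_surj nt' true.
  have nx1 : g (set_of_point x1) by rewrite /g set_of_pointK.
  case: b gE {fE} => gE; last first.
    have : f (set_of_point x1 :\ i) by rewrite gE !inE eqxx gD.
    have sub := subset_trans (subsetDl (set_of_point x1) [set i]) (subsetU1 i _).
    by move/(fm _ _ sub); rewrite gE !inE eqxx.
  have gm : mono g.
    move=> A B AB; have := fm _ _ (setUS [set i] AB).
    by rewrite !gE !inE !eqxx /= !gU.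
  have [|||-> ->] := @card_ext_and _ f g i gm => //.
  - exact: eval_irrel.
  - by apply: gm nx1; apply: subsetT.
  - by move=> A; rewrite gE eqb_id.
  by rewrite (IH g gm) // cardsU1 eval_irrel.
Qed.

(** Peeling off the variable given by [ext_splits] removes one extremal set and one relevant
    variable, so equality persists. The inclusion of [vars t] in [relvars f] keeps that variable out
    of the formula found by induction. *)
Lemma card_ext_nested (R : realFieldType) (w : 'I_n -> R) f :
  mono f -> separates w f -> #|ext f| = #|relvars f|.+1 ->
  (exists c, forall A, f A = c) \/
  exists t, [/\ nested t, vars t \subset relvars f & forall A, f A = eval t (point_of A)].
Proof.
have [N] := ubnP #|relvars f|; elim: N w f => // N IH w f fN fm fs fcard.
have [r0|rN0] := eqVneq (relvars f) set0.
  by left; exists (f set0) => A; apply: eq_mono_relvars; rewrite // r0 !setI0.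
have [a [ha|ha]] := ext_splits fm fs fcard rN0.
- have [f0|f0] := boolP (f set0).
    by left; exists true => A; apply: fm f0; apply: sub0set.
  pose g A := f (A :\ a).
  have gm : mono g := mono_D1 (a := a) fm.
  have ag : a \notin relvars g.
    by apply/relvarsP => -[A]; rewrite /g setDUl setDv set0U setDDl setUid => ->.
  have gE A : f A = (a \in A) || g A.
    have [/ha->//|aA] := boolP (a \in A).
    by rewrite /g (setDidPl _) // disjoint_sym disjoints1.
  have g0 : ~~ g set0 by rewrite /g set0D.
  have [ecard erel] := card_ext_or gm ag g0 gE.
  move: fN fcard; rewrite ecard erel cardsU1 ag => fN [gcard].
  have [[c gc]|[t [nt vt tE]]] := IH _ g fN gm (separates_D1 fs) gcard.
    right; exists (Lit a true); split=> [||A]; first exact: nested_Lit.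
      by rewrite subsetUl.
    by rewrite gE gc -(gc set0) (negbTE g0) orbF /= ffunE eqb_id.
  right; exists (Or (Lit a true) t); split=> [||A].
  - by apply: nested_Or => //; apply: contra ag => /(subsetP vt).
  - by rewrite setUS.
  - by rewrite gE tE /= ffunE eqb_id.
- have [fT|fT] := boolP (f setT); last first.
    left; exists false => A; apply: contraNF fT; apply/fm/subsetT.
  pose g A := f (a |: A).
  have gm : mono g := mono_U1 (a := a) fm.
  have ag : a \notin relvars g.
    have e A : a |: (A :\ a) = a |: A.
      by apply/setP => i; rewrite !inE; case: eqVneq.
    by apply/relvarsP => -[A]; rewrite /g setUA setUid e => ->.
  have gE A : f A = (a \in A) && g A.
    have [aA|/ha/negbTE//] := boolP (a \in A).
    by rewrite /g (setUidPr _) // sub1set.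
  have gT : g setT by rewrite /g setUT.
  have [ecard erel] := card_ext_and gm ag gT gE.
  move: fN fcard; rewrite ecard erel cardsU1 ag => fN [gcard].
  have [[c gc]|[t [nt vt tE]]] := IH _ g fN gm (separates_U1 fs) gcard.
    right; exists (Lit a true); split=> [||A]; first exact: nested_Lit.
      by rewrite subsetUl.
    by rewrite gE gc -(gc setT) gT andbT /= ffunE eqb_id.
  right; exists (And (Lit a true) t); split=> [||A].
  - by apply: nested_And => //; apply: contra ag => /(subsetP vt).
  - by rewrite setUS.
  - by rewrite gE tE /= ffunE eqb_id.
Qed.
End NestedCount.

(** * Transfer from set functions back to Boolean functions on points *)

Section Points.
Variables (n : nat) (f : boolfun n).
Let F (A : {set 'I_n}) := f (point_of A).

Lemma preceq_subset (x y : point n) :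
  preceq x y = (set_of_point x \subset set_of_point y).
Proof.
apply/forallP/subsetP => [h i|h i]; first by rewrite !inE => xi; have := h i; rewrite xi.
by apply/implyP => xi; have := h i; rewrite !inE; apply.
Qed.

Lemma positive_mono : positive f -> mono F.
Proof. by move=> fp A B AB fA; apply: fp fA _; rewrite preceq_subset !point_ofK. Qed.

Lemma threshold_separates (R : realType) :
  threshold R f -> exists w : 'I_n -> R, separates w F.
Proof.
case=> w [t fE]; exists w => A B fA nB.
have sE (C : {set 'I_n}) :
    (\sum_(i < n) w i * (point_of C i)%:R = \sum_(i in C) w i)%R.
  rewrite [RHS]big_mkcond /=; apply: eq_bigr => i _; rewrite ffunE.
  by case: ifP; rewrite ?mulr1 ?mulr0.
have /negbTE/fE := nB; rewrite sE => Bt; apply: le_lt_trans Bt _.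
by rewrite ltNge; apply/negP; rewrite -sE => /fE; rewrite -/(F A) fA.
Qed.

Lemma insert_coord_true (k : 'I_n) (y : point n.-1) (A : {set 'I_n}) :
  (forall j, (lift k j \in A) = y j) -> insert_coord k true y = point_of (k |: A).
Proof.
move=> yA; apply/ffunP => i; rewrite !ffunE in_setU1.
case: unliftP => [j ->|->]; last by rewrite eqxx.
by rewrite eq_sym (negbTE (neq_lift k j)) yA.
Qed.

Lemma insert_coord_false (k : 'I_n) (y : point n.-1) (A : {set 'I_n}) :
  (forall j, (lift k j \in A) = y j) -> insert_coord k false y = point_of (A :\ k).
Proof.
move=> yA; apply/ffunP => i; rewrite !ffunE in_setD1.
case: unliftP => [j ->|->]; last by rewrite eqxx.
by rewrite eq_sym (neq_lift k j) yA.
Qed.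

Lemma relevantE k : positive f -> relevant f k = (k \in relvars F).
Proof.
move=> /positive_mono fm; apply/existsP/relvarsP => [[y]|[A fA nA]].
  pose A := set_of_point (insert_coord k true y).
  have yA j : (lift k j \in A) = y j by rewrite inE ffunE liftK.
  rewrite /restriction (insert_coord_true yA) (insert_coord_false yA) => neq.
  have DU : A :\ k \subset k |: A := subset_trans (subsetDl _ _) (subsetU1 _ _).
  move: neq (fm _ _ DU); rewrite -/(F (k |: A)) -/(F (A :\ k)).
  case e1: (F (k |: A)); case e2: (F (A :\ k)) => // _ imp; last by have := imp isT.
  by exists A; rewrite ?e1 ?e2.
exists [ffun j => lift k j \in A]; rewrite /restriction.
rewrite (@insert_coord_true k _ A) => [|j]; last by rewrite ffunE.
rewrite (@insert_coord_false k _ A) => [|j]; last by rewrite ffunE.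
by move: fA nA; rewrite /F => -> /negbTE->.
Qed.

(** Local and global extremality agree: a false point strictly above [x] has an extra coordinate
    [i], and by monotonicity adding [i] alone to [x] already gives a false point; dually for true
    points. *)
Lemma extremalE x : positive f -> extremal f x = (set_of_point x \in ext F).
Proof.
move=> /positive_mono fm; rewrite /extremal in_setU; congr (_ || _).
  apply/andP/maxFP; rewrite /F set_of_pointK => -[fx h]; split=> //.
    move=> i ix.
    have := forallP h (point_of (i |: set_of_point x)).
    rewrite preceq_subset point_ofK subsetU1 andbT; apply: contraLR => nf.
    by rewrite nf /=; apply: contraNneq ix => e; rewrite -{1}e point_ofK setU11.
  apply/forallP => y; apply/implyP => /andP[fy xy]; rewrite eq_sym.
  rewrite -(can_eq (@set_of_pointK n)) eqEsubset -preceq_subset xy /=.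
  apply/subsetP => i iy; apply: contraT => /h fi; case/negP: fy.
  have := fm _ (set_of_point y) _ fi; rewrite /F set_of_pointK; apply.
  by rewrite subUset sub1set iy -preceq_subset.
apply/andP/minTP; rewrite /F set_of_pointK => -[fx h]; split=> //.
  move=> i ix.
  have := forallP h (point_of (set_of_point x :\ i)).
  rewrite preceq_subset point_ofK subsetDl andbT; apply: contraL => nf.
  by rewrite nf /=; apply: contraTneq ix => e; rewrite -{1}e point_ofK setD11.
apply/forallP => y; apply/implyP => /andP[fy yx].
rewrite -(can_eq (@set_of_pointK n)) eqEsubset -preceq_subset yx /=.
apply/subsetP => i ix; apply: contraT => iy; case/negP: (h i ix).
have := fm (set_of_point y) _ _; rewrite /F set_of_pointK; apply=> //.
by rewrite subsetD1 iy -preceq_subset yx.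
Qed.

Lemma card_extremal : positive f -> #|[set x | extremal f x]| = #|ext F|.
Proof.
move=> fp; rewrite -(card_imset _ (can_inj (@point_ofK n))); apply: eq_card => x.
rewrite inE (extremalE _ fp) -{2}[x]set_of_pointK.
by rewrite (mem_imset _ _ (can_inj (@point_ofK n))).
Qed.
End Points.

Theorem theorem6 (R : realType) (n k : nat) (f : boolfun n)
    (f_positive : positive f) (f_threshold : threshold R f)
    (f_relevant : #|[set i : 'I_n | relevant f i]| = k) :
  (k + 1 <= #|[set x : point n | extremal f x]|)%N /\
  (#|[set x : point n | extremal f x]| = (k + 1)%N <-> linear_read_once f).
Proof.
have fm := positive_mono f_positive.
have [w fs] := threshold_separates f_threshold.
rewrite card_extremal // addn1.
have <- : #|relvars (fun A => f (point_of A))| = k.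
  by rewrite -f_relevant; apply: eq_card => i; rewrite [RHS]inE relevantE.
split; first exact: card_ext_ge fm fs.
split=> [fcard|[[c fc]|[t nt tE]]].
- have [[c fc]|[t [nt _ tE]]] := card_ext_nested fm fs fcard; [left | right].
    by exists c => x; rewrite -(set_of_pointK x) fc.
  by exists t => // x; rewrite -(set_of_pointK x) tE.
- have r0 : relvars (fun A => f (point_of A)) = set0.
    by apply/setP => i; rewrite in_set0; apply/relvarsP => -[A]; rewrite !fc => ->.
  by rewrite (card_ext_const fm r0) r0 cards0.
- by apply: (nested_card_ext nt fm) => A; apply: tE.
Qed.
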